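(* Let $g_1,\ldots,g_r\in\mathbb{R}[x_1,\ldots,x_n]$, let $X=\{x\in\mathbb{R}^n: g_1(x)\ge 0,\ldots,g_r(x)\ge 0\}$, and let $f\in\mathbb{R}[x_1,\ldots,x_n]$ be nonnegative on $X$. Then there exists a sequence $(f_\nu)_{\nu\in\mathbb{N}}$ of elements of the quadratic module $P(g_1,\ldots,g_r)$ that converges to $f$ uniformly on compact subsets of $\mathbb{R}^n$. Moreover, the $f_\nu$ can be chosen from the cone $\mathcal{S}(g_1,\ldots,g_r)$, and such that $f_\nu$ converges to $f$ also in the $l_1$-norm.
   Context: $\sum\mathbb{R}[x]^2$ (resp. $\sum\mathbb{R}[t]^2$) denotes the set of finite sums of squares of polynomials in $\mathbb{R}[x]=\mathbb{R}[x_1,\ldots,x_n]$ (resp. in $\mathbb{R}[t]$, $t$ a single variable). The quadratic module is $P(g_1,\ldots,g_r)=\{\sigma_0+\sigma_1g_1+\cdots+\sigma_rg_r:\sigma_i\in\sum\mathbb{R}[x]^2,\ i=0,\ldots,r\}$. The cone $\mathcal{S}(g_1,\ldots,g_r)$ is $\{\sigma_0+\varphi(g_1)g_1+\cdots+\varphi(g_r)g_r:\sigma_0\in\sum\mathbb{R}[x]^2,\ \varphi\in\sum\mathbb{R}[t]^2\}$ (the same univariate $\varphi$ is used for all $i$; it may depend on the element of the cone). The $l_1$-norm of a polynomial is the sum of the absolute values of its coefficients in the usual monomial basis. *)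

(* Defs.v *)
From HB Require Import structures.
From mathcomp Require Import all_boot all_order all_algebra.
(* The notations of mpoly.v clash with those of mathcomp-analysis. *)
From mathcomp Require Import -(notations) mpoly.
From mathcomp Require Import all_classical all_reals all_analysis.

Set Implicit Arguments.
Unset Strict Implicit.
Unset Printing Implicit Defensive.

Import Order.TTheory GRing.Theory Num.Theory numFieldNormedType.Exports.

Local Open Scope classical_set_scope.
Local Open Scope ring_scope.

Definition sos (A : nzRingType) : set A :=
  [set p | exists s : seq A, p = \sum_(q <- s) q ^+ 2].

Definition mpfun (R : realType) (n : nat) (p : mpoly n R) : 'rV[R]_n -> R :=
  fun x => meval (x ord0) p.

Definition basic_closed (R : realType) (n r : nat) (g : 'I_r -> mpoly n R) :
    set 'rV[R]_n :=
  [set x | forall i, 0 <= mpfun (g i) x].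

Definition quadratic_module (R : realType) (n r : nat)
    (g : 'I_r -> mpoly n R) : set (mpoly n R) :=
  [set p | exists (s0 : mpoly n R) (s : 'I_r -> mpoly n R),
     [/\ sos s0, forall i, sos (s i) & p = s0 + \sum_(i < r) s i * g i]].

(* [horner_alg q phi] is the composite phi(q). *)
Definition univariate_cone (R : realType) (n r : nat)
    (g : 'I_r -> mpoly n R) : set (mpoly n R) :=
  [set p | exists (s0 : mpoly n R) (phi : {poly R}),
     [/\ sos s0, sos phi &
         p = s0 + \sum_(i < r) horner_alg (g i) phi * g i]].

Definition l1norm (R : realType) (n : nat) (p : mpoly n R) : R :=
  \sum_(m <- msupp p) `|mcoeff m p|.

(* Main.v *)
(** Fix [rho > 0] and weight the l1-norm by [rho ^ degree]: this norm is
submultiplicative and dominates the sup norm on the box [[-rho, rho]^n], and for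
[rho >= 1] also the l1-norm.  So it suffices to approximate [f] in each of these
norms and to let [rho] tend to infinity.

A polynomial [p >= 0] on the box is a limit of sums of squares.  With
[y_i = (1 + X_i / rho) / 2] and [z_i = (1 - X_i / rho) / 2], the polynomial
[p + e] is a nonnegative combination of Bernstein polynomials in the pairs
[(y_i, z_i)] of large degree.  If [t] has norm at
most 1, then [1 - t] is a limit of squares [(1 - u) ^ 2], where [u] runs through
the fixed point iteration for [u = (t + u ^ 2) / 2], which converges in norm because
it is majorized by the scalar iteration for [t = 1].  So [y_i] and [z_i] are limits
of squares, and hence so are their products.

It remains to make [f] nonnegative on the box up to [e] by subtracting
[sum_i phi (g_i) g_i].  The square [phi (t) = (1 - t / M) ^ (2 k)], where
[M >= |g_i|] on the box, works for large [k]: [phi (t) t] is at most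
[M / (2 k + 1)] on [[0, M]], while [- phi (t) t] is at least [2 k t ^ 2 / M] for
[t < 0], and compactness finishes. *)

Require Import Defs.
From HB Require Import structures.
From mathcomp Require Import all_boot all_order all_algebra.
From mathcomp Require Import -(notations) mpoly.
From mathcomp Require Import all_classical all_reals all_analysis.
From mathcomp Require Import ring lra zify.

Set Implicit Arguments.
Unset Strict Implicit.
Unset Printing Implicit Defensive.

Import Order.TTheory GRing.Theory Num.Theory numFieldNormedType.Exports.

Local Open Scope classical_set_scope.
Local Open Scope ring_scope.

(** * The weighted l1-norm *)

Section WeightedNorm.
Variables (R : realType) (n : nat) (rho : R).
Implicit Types p q : mpoly n R.

Definition wnorm p := \sum_(m <- msupp p) `|mcoeff m p| * rho ^+ mdeg m.

(** Terms outside the support vanish, so norms of polynomials with different supports can be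
    compared term by term over one common list. *)
Lemma wnorm_wide (s : seq (multinom n)) p : uniq s -> {subset msupp p <= s} ->
  wnorm p = \sum_(m <- s) `|mcoeff m p| * rho ^+ mdeg m.
Proof.
move=> us sub; rewrite [RHS](bigID (fun m => m \in msupp p)) /=.
rewrite [X in _ = _ + X]big1 => [|m /memN_msupp_eq0 ->]; last by rewrite normr0 mul0r.
rewrite addr0 -big_filter; apply/perm_big/uniq_perm; rewrite ?filter_uniq //.
by move=> m; rewrite mem_filter; case: (boolP (m \in _)) => // /sub ->.
Qed.

Hypothesis rho_ge0 : 0 <= rho.

Lemma wnorm_ge0 p : 0 <= wnorm p.
Proof. by apply: sumr_ge0 => m _; rewrite mulr_ge0 ?exprn_ge0. Qed.

Lemma wnormN p : wnorm (- p) = wnorm p.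
Proof.
rewrite [RHS](@wnorm_wide (msupp (- p))) //.
  by apply: eq_bigr => m _; rewrite mcoeffN normrN.
by move=> m; rewrite !mcoeff_msupp mcoeffN oppr_eq0.
Qed.

Lemma wnormD p q : wnorm (p + q) <= wnorm p + wnorm q.
Proof.
pose s := undup (msupp p ++ msupp q ++ msupp (p + q)).
have us : uniq s by exact: undup_uniq.
rewrite !(@wnorm_wide s) //; try by move=> m; rewrite mem_undup !mem_cat => ->;
  rewrite ?orbT.
rewrite -big_split; apply: ler_sum => m _ /=.
by rewrite -mulrDl ler_wpM2r ?exprn_ge0 // mcoeffD ler_normD.
Qed.

Lemma wnorm_sum (I : Type) (s : seq I) (P : pred I) (F : I -> mpoly n R) :
  wnorm (\sum_(i <- s | P i) F i) <= \sum_(i <- s | P i) wnorm (F i).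
Proof.
elim/big_ind2: _ => [|p a q b pa qb|//].
  by rewrite /wnorm msupp0 big_nil.
exact: le_trans (wnormD _ _) (lerD pa qb).
Qed.

Lemma wnormZ c p : wnorm (c *: p) = `|c| * wnorm p.
Proof.
rewrite (@wnorm_wide (msupp p)) ?msupp_uniq //.
  by rewrite mulr_sumr; apply: eq_bigr => m _; rewrite mcoeffZ normrM mulrA.
by move=> m; rewrite !mcoeff_msupp mcoeffZ mulf_eq0 negb_or => /andP[].
Qed.

Lemma wnormX m : wnorm (mpolyX R m) = rho ^+ mdeg m.
Proof. by rewrite /wnorm msuppX big_seq1 mcoeffX eqxx normr1 mul1r. Qed.

Lemma wnorm1 : wnorm 1 = 1.
Proof. by rewrite -mpolyX0 wnormX mdeg0 expr0. Qed.

Lemma wnormC c : wnorm (mpolyC n c) = `|c|.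
Proof. by rewrite -alg_mpolyC wnormZ wnorm1 mulr1. Qed.

Lemma wnormM p q : wnorm (p * q) <= wnorm p * wnorm q.
Proof.
rewrite [p in p * q]mpolyE [q in _ * q]mpolyE mulr_suml.
apply: le_trans (wnorm_sum _ _ _) _; rewrite [leRHS]mulr_suml.
apply: ler_sum => m _; rewrite mulr_sumr.
apply: le_trans (wnorm_sum _ _ _) _; rewrite [leRHS]mulr_sumr.
apply: ler_sum => k _; rewrite -scalerAl -scalerAr -mpolyXD !wnormZ wnormX.
by rewrite mdegD exprD !mulrA -(mulrA `|_|) (mulrC `|mcoeff k q|) !mulrA.
Qed.

Lemma norm_meval_le_wnorm (v : 'I_n -> R) p :
  (forall i, `|v i| <= rho) -> `|meval v p| <= wnorm p.
Proof.
move=> v_le; rewrite mevalE; apply: le_trans (ler_norm_sum _ _ _) _.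
apply: ler_sum => m _; rewrite normrM ler_wpM2l // normr_prod mdegE expr_sum.
by apply: ler_prod => i _; rewrite normr_ge0 normrX lerXn2r ?nnegrE.
Qed.

End WeightedNorm.

Lemma l1norm_le_wnorm (R : realType) (n : nat) (rho : R) (p : mpoly n R) :
  1 <= rho -> l1norm p <= wnorm rho p.
Proof.
by move=> rho1; apply: ler_sum => m _; rewrite ler_peMr // exprn_ege1.
Qed.

(** * Norm limits of squares and of sums of squares *)

Section LimitsOfSquares.
Variables (R : realType) (n : nat) (rho : R).
Hypothesis rho_ge0 : 0 <= rho.
Implicit Types p q t : mpoly n R.
Local Notation nrm := (@wnorm R n rho).

(** Single squares, kept apart from sums: they are stable under products by
    [a ^+ 2 * b ^+ 2 = (a * b) ^+ 2]. *)
Definition square_limit p := forall e, 0 < e -> exists q, nrm (p - q ^+ 2) < e.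

Definition sos_limit p :=
  forall e, 0 < e -> exists2 s, sos s & nrm (p - s) < e.

(* Iteration towards [u = 1 - sqrt (1 - t)]. *)
Fixpoint sqrt_iter (A : lalgType R) (t : A) k : A :=
  if k is k'.+1 then 2^-1 *: (t + sqrt_iter t k' ^+ 2) else 0.

(** The scalar majorant: its values and increments bound in norm those of [sqrt_iter t] when [t] has
    norm at most 1. *)
Definition sqrt_iter1 k : R := sqrt_iter (1 : R^o) k.

Lemma sqrt_iter1S k : sqrt_iter1 k.+1 = (1 + sqrt_iter1 k ^+ 2) / 2.
Proof. by rewrite mulrC. Qed.

(** The iterate after [1 - b] is [1 - (b - b ^+ 2 / 2)], and [b = 2 / x] satisfies
    [b - b ^+ 2 / 2 <= 2 / (x + 1)]. *)
Lemma sqrt_iter1_bound k : 1 - 2 / k.+2%:R <= sqrt_iter1 k <= 1.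
Proof.
elim: k => [|k /andP[lo hi]].
  by rewrite /sqrt_iter1 /= divff ?subrr ?lexx ?ler01 ?pnatr_eq0.
rewrite sqrt_iter1S.
have ak_ge0 : 0 <= sqrt_iter1 k.
  by apply: le_trans lo; rewrite subr_ge0 ler_pdivrMr ?ltr0n // mul1r ler_nat.
apply/andP; split; last by nra.
have x2 : 2 <= k.+2%:R :> R by rewrite ler_nat.
rewrite -[k.+3%:R]natr1; move: (k.+2%:R) x2 lo => x x2 lo.
have x0 : 0 < x by lra.
have step : 2 / x - (2 / x) ^+ 2 / 2 <= 2 / (x + 1).
  have -> : 2 / x - (2 / x) ^+ 2 / 2 = (2 * (x - 1)) / x ^+ 2 by field; lra.
  by rewrite ler_pdivrMr ?exprn_gt0 // mulrAC ler_pdivlMr; [nra|lra].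
have b0 : 0 < 2 / x by rewrite divr_gt0.
have b1 : 2 / x <= 1 by rewrite ler_pdivrMr // mul1r.
move: lo step b0 b1; set b := 2 / x; set c := 2 / (x + 1) => lo step b0 b1.
have : (1 - b) ^+ 2 <= sqrt_iter1 k ^+ 2 by rewrite lerXn2r ?nnegrE //; lra.
lra.
Qed.

Lemma wnorm_sqrt_iter t k : nrm t <= 1 -> nrm (sqrt_iter t k) <= sqrt_iter1 k.
Proof.
move=> t1; elim: k => [|k ih]; first by rewrite /= /wnorm msupp0 big_nil.
rewrite sqrt_iter1S /= wnormZ ger0_norm ?invr_ge0 // mulrC ler_pM2r ?invr_gt0 //.
apply: le_trans (wnormD rho_ge0 _ _) _; rewrite lerD //.
apply: le_trans (wnormM rho_ge0 _ _) _.
by rewrite expr2 ler_pM // wnorm_ge0.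
Qed.

(** Each increment is half a difference of squares, hence half the product of the previous increment
    with a sum of iterates. The scalar increments obey the same recursion, and both factors are
    majorized. *)
Lemma wnorm_sqrt_iter_diff t k : nrm t <= 1 ->
  nrm (sqrt_iter t k.+1 - sqrt_iter t k) <= sqrt_iter1 k.+1 - sqrt_iter1 k.
Proof.
move=> t1; elim: k => [|k ih].
  rewrite !subr0; exact: (@wnorm_sqrt_iter _ 1).
set d := nrm _ in ih.
have -> : sqrt_iter t k.+2 - sqrt_iter t k.+1 = 2^-1 *:
   ((sqrt_iter t k.+1 - sqrt_iter t k) * (sqrt_iter t k.+1 + sqrt_iter t k)).
  have -> (x y : mpoly n R) : (x - y) * (x + y) = (t + x ^+ 2) - (t + y ^+ 2) by ring.
  by rewrite scalerBr.
rewrite wnormZ ger0_norm ?invr_ge0 // [X in _ <= X - _]sqrt_iter1S.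
have := wnormM rho_ge0 (sqrt_iter t k.+1 - sqrt_iter t k)
                       (sqrt_iter t k.+1 + sqrt_iter t k).
rewrite -/d; set e := nrm (_ * _); set f := nrm (_ + _) => le1.
have le2 : f <= sqrt_iter1 k.+1 + sqrt_iter1 k.
  by apply: le_trans (wnormD rho_ge0 _ _) _; rewrite lerD // wnorm_sqrt_iter.
have d0 : 0 <= d by apply: wnorm_ge0.
have f0 : 0 <= f by apply: wnorm_ge0.
have : d * f <= (sqrt_iter1 k.+1 - sqrt_iter1 k) * (sqrt_iter1 k.+1 + sqrt_iter1 k).
  exact: ler_pM.
rewrite (sqrt_iter1S k); nra.
Qed.

(** The residual of the square [(1 - u_k) ^+ 2] is [-2] times the increment [u_(k+1) - u_k]. With
    [a = sqrt_iter1 k] its norm is thus at most [(1 - a) ^+ 2 <= 1 - a], which tends to 0. *)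
Lemma square_limit_1B t : nrm t <= 1 -> square_limit (1 - t).
Proof.
move=> t1 e e0; pose k := Num.truncn (4 / e); exists (1 - sqrt_iter t k).
have -> : 1 - t - (1 - sqrt_iter t k) ^+ 2 =
          (- 2) *: (sqrt_iter t k.+1 - sqrt_iter t k).
  rewrite scalerBr /= scalerA mulNr divff ?pnatr_eq0 //.
  rewrite !scaleNr scale1r -[2]/(1 + 1) scalerDl scale1r; ring.
rewrite wnormZ normrN ger0_norm //.
have := wnorm_sqrt_iter_diff k t1; rewrite sqrt_iter1S.
have /andP[] := sqrt_iter1_bound k.
have : 2 / k.+2%:R < e / 2.
  have := truncnS_gt (4 / e); rewrite -/k -[k.+2%:R]natr1 => hk.
  have : (0 : R) < k.+1%:R by [].
  move: (k.+1%:R) hk => x; rewrite ltr_pdivrMr // => hk x0.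
  rewrite ltr_pdivrMr; [nra|lra].
have : (0 : R) < 2 / k.+2%:R by rewrite divr_gt0.
have : 2 / k.+2%:R <= 1 :> R by rewrite ler_pdivrMr // mul1r ler_nat.
move: (2 / k.+2%:R) => b b1 b0 hb lo hi.
set a := sqrt_iter1 k in lo hi *; set c := nrm _ => hc.
have : (1 - a) ^+ 2 <= 1 - a by nra.
lra.
Qed.

Lemma square_limit1 : square_limit 1.
Proof.
rewrite -[X in square_limit X]subr0; apply: square_limit_1B.
by rewrite /wnorm msupp0 big_nil.
Qed.

Lemma square_limitM p q : square_limit p -> square_limit q -> square_limit (p * q).
Proof.
move=> sp sq e e0; have np := wnorm_ge0 rho_ge0 p.
have d0 : 0 < Num.min 1 (e / (2 * (1 + nrm p))).
  by rewrite lt_min ltr01 divr_gt0 // mulr_gt0 //; lra.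
have [b] := sq _ d0; rewrite lt_min => /andP[_ hb].
have nb := wnorm_ge0 rho_ge0 (b ^+ 2).
(* The tolerance for [p] depends on [b], so [q] had to be approximated first. *)
have d1 : 0 < e / (2 * (1 + nrm (b ^+ 2))).
  by rewrite divr_gt0 // mulr_gt0 //; lra.
have [a ha] := sp _ d1.
exists (a * b).
have -> : p * q - (a * b) ^+ 2 = p * (q - b ^+ 2) + (p - a ^+ 2) * b ^+ 2 by ring.
apply: le_lt_trans (wnormD rho_ge0 _ _) _.
apply: le_lt_trans (lerD (wnormM rho_ge0 _ _) (wnormM rho_ge0 _ _)) _.
move: hb ha; rewrite !ltr_pdivlMr; try by rewrite mulr_gt0 //; lra.
have := wnorm_ge0 rho_ge0 (q - b ^+ 2).
have := wnorm_ge0 rho_ge0 (p - a ^+ 2).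
nra.
Qed.

Lemma square_limitX p k : square_limit p -> square_limit (p ^+ k).
Proof.
move=> sp; elim: k => [|k ih]; first by rewrite expr0; exact: square_limit1.
by rewrite exprS; exact: square_limitM.
Qed.

Lemma square_limitZ c p : 0 <= c -> square_limit p -> square_limit (c *: p).
Proof.
move=> c0 sp e e0.
have d0 : 0 < e / (c + 1) by rewrite divr_gt0 //; lra.
have [q hq] := sp _ d0; exists (Num.sqrt c *: q).
rewrite exprZn sqr_sqrtr // -scalerBr wnormZ ger0_norm //.
have := wnorm_ge0 rho_ge0 (p - q ^+ 2).
move: hq; rewrite ltr_pdivlMr; [nra|lra].
Qed.

Lemma sos_limit_square p : square_limit p -> sos_limit p.
Proof.
by move=> sp e /sp[q hq]; exists (q ^+ 2) => //; exists [:: q]; rewrite big_seq1.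
Qed.

Lemma sos_limit0 : sos_limit 0.
Proof.
move=> e e0; exists 0; first by exists [::]; rewrite big_nil.
by rewrite subr0 /wnorm msupp0 big_nil.
Qed.

Lemma sos_limitD p q : sos_limit p -> sos_limit q -> sos_limit (p + q).
Proof.
move=> sp sq e e0; have e20 : 0 < e / 2 by rewrite divr_gt0.
have [a [sa ->] ha] := sp _ e20; have [b [sb ->] hb] := sq _ e20.
exists (\sum_(c <- sa ++ sb) c ^+ 2); first by exists (sa ++ sb).
rewrite big_cat opprD addrACA; apply: le_lt_trans (wnormD rho_ge0 _ _) _; lra.
Qed.

Lemma sos_limit_sum (I : Type) (s : seq I) (P : pred I) (F : I -> mpoly n R) :
  (forall i, P i -> sos_limit (F i)) -> sos_limit (\sum_(i <- s | P i) F i).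
Proof. by move=> sF; apply: big_ind => //; [exact: sos_limit0|exact: sos_limitD]. Qed.

End LimitsOfSquares.

(** * Bernstein expansions *)

Section Bernstein.
Variable R : realType.

(* The coefficient of [y ^ m] on the [k]-th Bernstein polynomial of degree [N]
   is the quotient of falling factorials [k ^_ m / N ^_ m], close to [(k / N) ^ m]. *)
Fixpoint bernstein_coef (m N k : nat) : R :=
  if m is m'.+1 then k%:R / N%:R * bernstein_coef m' N.-1 k.-1 else 1.

(** For [m = 0] this is the binomial theorem for [(z + y) ^+ N]. Otherwise one factor [y] multiplies
    the expansion of degree [N - 1], shifting [k] by one; the term [k = 0] has coefficient 0. *)
Lemma bernstein_expansion (A : comAlgType R) (y z : A) (m N : nat) :
  y + z = 1 -> (m <= N)%N ->
  y ^+ m = \sum_(k < N.+1)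
    bernstein_coef m N k *: (z ^+ (N - k) * y ^+ k *+ 'C(N, k)).
Proof.
move=> yz; elim: m N => [|m ih] [|N] // mN.
- by rewrite big_ord_recl big_ord0 /= bin0 !mulr1 scale1r addr0.
- rewrite expr0 -[LHS](expr1n _ N.+1) -yz addrC exprDn.
  by apply: eq_bigr => k _; rewrite /= scale1r.
rewrite big_ord_recl /= !mul0r scale0r add0r exprS (ih N) // mulr_sumr.
apply: eq_bigr => k _; rewrite /bump /= add1n subSS.
rewrite -scalerAr mulrnAr exprS [z ^+ _ * (y * _)]mulrCA.
set M : A := y * _; set b := bernstein_coef m N k.
rewrite -[in LHS](scaler_nat _ M) -[in RHS](scaler_nat _ M) !scalerA.
congr (_ *: M); have := congr1 (fun i : nat => i%:R : R) (mul_bin_diag N.+1 k).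
rewrite /= !natrM => h; have N0 : N.+1%:R != 0 :> R by rewrite pnatr_eq0.
apply: (mulfI N0); rewrite mulrCA h.
by move: (k.+1%:R) (N.+1%:R) ('C(_, _)%:R) N0 => u v w v0; field.
Qed.

Lemma bernstein_coef_range (m N k : nat) : (k <= N)%N ->
  0 <= bernstein_coef m N k <= 1.
Proof.
elim: m N k => [|m ih] N k kN /=; first by rewrite ler01 lexx.
have /andP[b0 b1] : 0 <= bernstein_coef m N.-1 k.-1 <= 1 by apply: ih; lia.
have q0 : 0 <= k%:R / N%:R :> R by rewrite divr_ge0.
have q1 : k%:R / N%:R <= 1 :> R.
  case: N kN {ih b0 b1 q0} => [|N] kN; first by rewrite invr0 mulr0.
  by rewrite ler_pdivrMr ?ltr0n // mul1r ler_nat.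
nra.
Qed.

Lemma expr_lipschitz (a b : R) m : 0 <= a <= 1 -> 0 <= b <= 1 ->
  `|a ^+ m - b ^+ m| <= m%:R * `|a - b|.
Proof.
move=> a01 b01; elim: m => [|m ih]; first by rewrite subrr normr0 mul0r.
have -> : a ^+ m.+1 - b ^+ m.+1 = a * (a ^+ m - b ^+ m) + (a - b) * b ^+ m.
  by rewrite !exprS; ring.
apply: le_trans (ler_normD _ _) _; rewrite !normrM -natr1.
have : `|b ^+ m| <= 1 by rewrite normrX exprn_ile1 // ger0_norm; lra.
have : `|a| <= 1 by rewrite ger0_norm; lra.
have := normr_ge0 a; have := normr_ge0 (a - b).
have := normr_ge0 (b ^+ m); have := normr_ge0 (a ^+ m - b ^+ m).
nra.
Qed.

(** After removing a common factor [k / N <= 1], the induction hypothesis compares with a power of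
    [(k - 1) / (N - 1)], which is within [1 / N] of [k / N]. Going from [m] to [m + 1], the errors
    [m ^ 2 / (N - 1)] and [m / N] add up to at most [(m + 1) ^ 2 / N]. *)
Lemma bernstein_coef_close (m N k : nat) : (m <= N)%N -> (k <= N)%N ->
  `|bernstein_coef m N k - (k%:R / N%:R) ^+ m| <= (m ^ 2)%:R / N%:R.
Proof.
elim: m N k => [|m ih] [|N] k // mN kN; rewrite ?subrr ?normr0 ?divr_ge0 //.
case: k kN => [|k] kN; first by rewrite /= !mul0r expr0n subr0 normr0 divr_ge0.
rewrite [bernstein_coef _ _ _]/= exprS -mulrBr normrM ger0_norm ?divr_ge0 //.
set b := bernstein_coef _ _ _; set x : R := k.+1%:R / N.+1%:R.
have x01 : 0 <= x <= 1.
  by rewrite divr_ge0 // ler_pdivrMr ?ltr0n // mul1r ler_nat.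
apply: (@le_trans _ _ `|b - x ^+ m|).
  by have := normr_ge0 (b - x ^+ m); nra.
(* Exponent 1 is treated apart because [N] may then be 0; otherwise [m.+1 <= N] makes [N]
   positive. *)
case: m ih mN @b => [|m] ih mN b.
  by rewrite /b /= expr0 subrr normr0 divr_ge0.
have N0 : (0 : R) < N%:R by rewrite ltr0n; lia.
pose w : R := k%:R / N%:R.
have w01 : 0 <= w <= 1.
  by rewrite divr_ge0 // ler_pdivrMr // mul1r ler_nat.
rewrite -(subrK (w ^+ m.+1) b) -addrA.
apply: le_trans (ler_normD _ _) _.
have h1 := ih N k (ltac:(lia)) (ltac:(lia)).
have h2 := @expr_lipschitz w x m.+1 w01 x01.
have h3 : `|w - x| <= N.+1%:R^-1.
  have N1 : (0 : R) < N.+1%:R by rewrite ltr0n.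
  have kN' : k%:R <= N%:R :> R by rewrite ler_nat.
  have -> : w - x = - ((N%:R - k%:R) / N%:R / N.+1%:R).
    by rewrite /w /x -!natr1; field; rewrite natr1; lra.
  rewrite normrN ger0_norm; last by rewrite !divr_ge0 //; lra.
  rewrite ler_piMl ?invr_ge0 // ler_pdivrMr // mul1r.
  by have : (0 : R) <= k%:R by []; lra.
apply: le_trans (lerD h1 h2) _.
apply: (@le_trans _ _ ((m.+1 ^ 2)%:R / N%:R + m.+1%:R / N.+1%:R)).
  by rewrite lerD // ler_wpM2l.
have mN' : m.+1%:R <= N%:R :> R by rewrite ler_nat.
have : (0 : R) < m.+1%:R by rewrite ltr0n.
rewrite !natrX -[m.+2%:R]natr1 -[N.+1%:R]natr1.
move: (m.+1%:R) (N%:R) mN' N0 => M x' Mx x0 M0.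
rewrite ler_pdivlMr; last by lra.
have -> : (M ^+ 2 / x' + M / (x' + 1)) * (x' + 1) = M ^+ 2 + M + M ^+ 2 / x'.
  by field; lra.
have : M ^+ 2 / x' <= M by rewrite ler_pdivrMr //; nra.
lra.
Qed.

Lemma prod_lipschitz (I : Type) (s : seq I) (a b : I -> R) :
  (forall i, 0 <= a i <= 1) -> (forall i, 0 <= b i <= 1) ->
  `|\prod_(i <- s) a i - \prod_(i <- s) b i| <= \sum_(i <- s) `|a i - b i|.
Proof.
move=> a01 b01; elim: s => [|i s ih]; first by rewrite !big_nil subrr normr0.
rewrite !big_cons.
set P := \prod_(_ <- _) _; set Q := \prod_(_ <- _) _; set S := \sum_(_ <- _) _.
have Q0 : 0 <= Q by apply: prodr_ge0 => j _; have /andP[] := b01 j.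
have Q1 : Q <= 1 by apply: prodr_ile1 => j _; exact: b01.
have -> : a i * P - b i * Q = a i * (P - Q) + (a i - b i) * Q by ring.
apply: le_trans (ler_normD _ _) _; rewrite !normrM (ger0_norm Q0).
have /andP[a0 a1] := a01 i; rewrite (ger0_norm a0).
have := normr_ge0 (a i - b i); have := normr_ge0 (P - Q).
move: ih; rewrite -/P -/Q -/S; nra.
Qed.

(** The Bernstein coefficient of [q] at [k] is within [e] of the value of [q] at the grid point
    [k / N], which is nonnegative. Adding [e] to [q] adds [e] to every coefficient. *)
Lemma box_bernstein (n l : nat) (q : mpoly n R) (y z : n.-tuple (mpoly l R)) (e : R) :
  (forall v : 'I_n -> R, (forall i, 0 <= v i <= 1) -> 0 <= meval v q) ->
  (forall i, tnth y i + tnth z i = 1) -> 0 < e ->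
  exists (N : nat) (c : {ffun 'I_n -> 'I_N.+1} -> R), (forall k, 0 <= c k) /\
    comp_mpoly y q + mpolyC l e = \sum_k c k *:
      \prod_i (tnth z i ^+ (N - k i) * tnth y i ^+ k i *+ 'C(N, k i)).
Proof.
move=> q0 yz e0.
pose B := \sum_(m <- msupp q) `|mcoeff m q| * \sum_i ((m i) ^ 2)%:R.
have B0 : 0 <= B by apply: sumr_ge0 => m _; rewrite mulr_ge0 // sumr_ge0.
(* The first bound lets every monomial of [q] be expanded in degree [N]; the second gives
   [B / N <= e]. *)
pose N := maxn (\max_(m <- msupp q) \max_i m i) (Num.truncn (B / e)).+1.
have mN m i : m \in msupp q -> (m i <= N)%N.
  move=> mq; rewrite leq_max; apply/orP; left.
  by rewrite (leq_trans (leq_bigmax i)) //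
    (leq_bigmax_seq (F := fun m : multinom n => \max_i m i)%N).
have N0 : (0 : R) < N%:R by rewrite ltr0n leq_max orbT.
have BN : B / N%:R <= e.
  rewrite ler_pdivrMr // mulrC -ler_pdivrMr //.
  by rewrite (le_trans (ltW (truncnS_gt _))) // ler_nat leq_maxr.
pose c (k : {ffun 'I_n -> 'I_N.+1}) :=
  \sum_(m <- msupp q) mcoeff m q * \prod_i bernstein_coef (m i) N (k i).
exists N, (fun k => c k + e); split.
  move=> k; pose v i : R := (k i)%:R / N%:R.
  have v01 i : 0 <= v i <= 1.
    by rewrite divr_ge0 // ler_pdivrMr // mul1r ler_nat; exact: ltn_ord (k i).
  have := q0 v v01; rewrite mevalE => qv.
  have : `|c k - \sum_(m <- msupp q) mcoeff m q * \prod_i v i ^+ m i| <= B / N%:R.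
    rewrite /c -sumrB /B mulr_suml; apply: le_trans (ler_norm_sum _ _ _) _.
    rewrite big_seq [leRHS]big_seq; apply: ler_sum => m mq.
    rewrite -mulrBr normrM -mulrA; rewrite ler_wpM2l // mulr_suml.
    apply: (@le_trans _ _ (\sum_i `|bernstein_coef (m i) N (k i) - v i ^+ m i|)).
      apply: prod_lipschitz => i.
        by apply: bernstein_coef_range; exact: ltn_ord (k i).
      by rewrite exprn_ge0 ?exprn_ile1 //; have /andP[] := v01 i.
    by apply: ler_sum => i _; apply: bernstein_coef_close;
      [exact: mN|exact: ltn_ord (k i)].
  by rewrite ler_norml => /andP[h _]; lra.
have prodE (m : 'I_n -> nat) : (forall i, m i <= N)%N ->
    \prod_i tnth y i ^+ m i = \sum_(k : {ffun 'I_n -> 'I_N.+1})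
      (\prod_i bernstein_coef (m i) N (k i)) *:
      \prod_i (tnth z i ^+ (N - k i) * tnth y i ^+ k i *+ 'C(N, k i)).
  move=> mleN.
  under eq_bigr => i _ do rewrite (@bernstein_expansion _ _ (tnth z i) _ N) //.
  by rewrite bigA_distr_bigA; apply: eq_bigr => k _; rewrite scaler_prod.
under [RHS]eq_bigr => k _ do rewrite scalerDl.
rewrite big_split /=; congr (_ + _); last first.
  (* The expansion of the constant monomial says that the Bernstein products sum to 1. *)
  rewrite -scaler_sumr; have := prodE (fun=> 0%N) (fun=> isT).
  rewrite big1 // => /esym; under eq_bigr => k _ do rewrite big1 // scale1r.
  by move=> ->; rewrite alg_mpolyC.
rewrite comp_mpolyE /c; under [RHS]eq_bigr => k _ do rewrite scaler_suml.
rewrite exchange_big /= big_seq [RHS]big_seq; apply: eq_bigr => m mq.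
rewrite prodE => [|i]; last exact: mN.
by rewrite scaler_sumr; apply: eq_bigr => k _; rewrite scalerA.
Qed.

End Bernstein.

(** * Polynomials nonnegative on a box *)

Lemma comp_mpolyK (R : comNzRingType) (n : nat) (t y : n.-tuple (mpoly n R))
    (p : mpoly n R) : (forall i, comp_mpoly y (tnth t i) = mpolyX R (mnm1 i)) ->
  comp_mpoly y (comp_mpoly t p) = p.
Proof.
move=> yt; rewrite -[RHS]comp_mpoly_id [comp_mpoly t p]comp_mpolyE [RHS]comp_mpolyE.
rewrite linear_sum; apply: eq_bigr => m _; rewrite linearZ /= rmorph_prod.
congr (_ *: _); apply: eq_bigr => i _.
by rewrite rmorphXn /= yt tnth_mktuple.
Qed.

Lemma sos_limit_box (R : realType) (n : nat) (rho : R) (p : mpoly n R) : 0 < rho ->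
  (forall v : 'I_n -> R, (forall i, `|v i| <= rho) -> 0 <= meval v p) ->
  sos_limit rho p.
Proof.
move=> rho0 p0 e e0; have rho_ge0 := ltW rho0.
pose X i := mpolyX R (mnm1 (i : 'I_n)).
(* [t] maps the unit cube onto the box, [y] is its inverse, and [z] is the complement [1 - y]. *)
pose t := [tuple rho *: (2%:R *: X i - 1) | i < n].
pose y := [tuple 2^-1 *: (1 + rho^-1 *: X i) | i < n].
pose z := [tuple 2^-1 *: (1 - rho^-1 *: X i) | i < n].
have tE i : tnth t i = rho *: (2%:R *: X i - 1) by rewrite tnth_mktuple.
have yE i : tnth y i = 2^-1 *: (1 + rho^-1 *: X i) by rewrite tnth_mktuple.
have zE i : tnth z i = 2^-1 *: (1 - rho^-1 *: X i) by rewrite tnth_mktuple.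
have tK : comp_mpoly y (comp_mpoly t p) = p.
  apply: comp_mpolyK => i.
  rewrite tE comp_mpolyZ comp_mpolyB comp_mpoly1 comp_mpolyZ comp_mpolyXU -tnth_nth.
  rewrite yE. rewrite [2%:R *: _]scalerA divff ?pnatr_eq0 // scale1r addrC addKr.
  by rewrite scalerA divff ?gt_eqF // scale1r.
have yz i : tnth y i + tnth z i = 1.
  rewrite yE zE -scalerDr addrACA subrr addr0 scalerDr -scalerDl.
  by rewrite (_ : 2^-1 + 2^-1 = 1) ?scale1r //; field.
have q0 (v : 'I_n -> R) : (forall i, 0 <= v i <= 1) -> 0 <= meval v (comp_mpoly t p).
  move=> v01; rewrite comp_mpoly_meval; apply: p0 => i; rewrite tE.
  rewrite mevalZ mevalB meval1 mevalZ mevalXU normrM ger0_norm // ler_piMr //.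
  by rewrite ler_norml; have := v01 i; lra.
have e20 : 0 < e / 2 by rewrite divr_gt0.
have sXr i (c : R) : `|c| <= rho^-1 -> square_limit rho (1 + c *: X i).
  move=> crho; rewrite -[c *: _]opprK; apply: square_limit_1B => //.
  rewrite wnormN wnormZ wnormX mdeg1 expr1.
  by rewrite -(mulVf (lt0r_neq0 rho0)) ler_wpM2r.
have [N [c [c0 pE]]] := box_bernstein q0 yz e20.
rewrite tK in pE.
have : sos_limit rho (p + mpolyC n (e / 2)).
  rewrite pE; apply: sos_limit_sum => // k _; apply: sos_limit_square.
  apply: square_limitZ => //; elim/big_ind: _ => [||i _].
  - exact: square_limit1.
  - by move=> *; exact: square_limitM.
  rewrite -scaler_nat; apply: square_limitZ => //.
  by apply: square_limitM => //; apply: square_limitX => //;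
    rewrite ?yE ?zE; apply: square_limitZ; rewrite ?invr_ge0 // -?scaleNr;
    apply: sXr; rewrite ?normrN ger0_norm ?invr_ge0.
move=> /(_ _ e20)[s sos_s hs]; exists s => //.
have -> : p - s = (p + mpolyC n (e / 2) - s) - mpolyC n (e / 2) by ring.
apply: le_lt_trans (wnormD rho_ge0 _ _) _.
rewrite wnormN wnormC (gtr0_norm e20).
by rewrite [ltRHS]splitr ltrD2r.
Qed.

(** * Penalty terms on compact sets *)

Lemma mpfun_continuous (R : realType) (n : nat) (p : mpoly n R) : continuous (mpfun p).
Proof.
rewrite /mpfun; under eq_fun do rewrite mevalE.
apply: continuous_big => [|m _]; first exact: add_continuous.
have cm : continuous (fun x : 'rV[R]_n => \prod_i x ord0 i ^+ m i).
  apply: continuous_big => [|i _ x]; first by move=> z; exact: cvgM cvg_fst cvg_snd.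
  exact: continuous_comp (@coord_continuous _ _ _ _ _ x) (@exprn_continuous _ _ _).
by move=> x; exact: cvgM (cvg_cst _) (cm x).
Qed.

(** Near a zero of [w], continuity keeps [f] above [- e]. Near any other point, [w] is bounded below
    by a positive constant, whose large multiples outweigh [f]. Compactness makes the threshold
    uniform. *)
Lemma compact_penalty (R : realType) (T : topologicalType) (K : set T) (f w : T -> R)
    (e : R) : compact K -> continuous f -> continuous w ->
  (forall x, 0 <= w x) -> (forall x, w x = 0 -> 0 <= f x) -> 0 < e ->
  exists k0 : nat, forall k x, (k0 <= k)%N -> K x -> - e <= f x + k%:R * w x.
Proof.
move=> /compact_near_coveringP cK cf cw w0 fw e0.
suff near_pos x : K x -> \forall x' \near x & k \near \oo, - e <= f x' + k%:R * w x'.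
  have [k0 _ hk0] := cK nat \oo _ _ near_pos.
  by exists k0 => k x k0k; exact: hk0.
move=> Kx; have [wx|wx] := eqVneq (w x) 0.
  near=> x' k; rewrite /=.
  have : - e < f x' by near: x'; apply: cvgr_gt (cf x) _ _; have := fw _ wx; lra.
  have : 0 <= k%:R * w x' by rewrite mulr_ge0.
  lra.
have wx0 : 0 < w x by rewrite lt_neqAle eq_sym wx w0.
near=> x' k => /=.
have h1 : f x - 1 < f x'.
  by near: x'; apply: cvgr_gt (cf x) _ _; lra.
have h2 : w x / 2 < w x'.
  by near: x'; apply: cvgr_gt (cw x) _ _; lra.
have h3 : (`|f x - 1| / (w x / 2)) <= k%:R.
  near: k; exact: nbhs_infty_ger.
move: h3; rewrite ler_pdivrMr; last by lra.
have := ler_norm (- (f x - 1)); rewrite normrN.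
have : (0 : R) <= k%:R by [].
nra.
Unshelve. all: by end_near. Qed.

(** As [|t| - t] is 0 for [t >= 0] and [- 2 * t] otherwise, one formula covers both signs. With
    [u = t / M], the case [u >= 0] uses [(1 - u) ^+ j * (1 + j * u) <= 1], and the case [u < 0] is
    Bernoulli's inequality. *)
Lemma penalty_lower_bound (R : realType) (M t : R) (j : nat) : 0 < M -> `|t| <= M ->
  j%:R / (4 * M) * (`|t| - t) ^+ 2 - M / j.+1%:R <= - ((1 - t / M) ^+ j * t).
Proof.
move=> M0 tM; have tE : t = M * (t / M) by rewrite mulrC divfK ?gt_eqF.
set u := t / M in tE *; have uM : `|u| <= 1.
  by rewrite normrM normfV (gtr0_norm M0) ler_pdivrMr // mul1r.
have [u0|u0] := leP 0 u.
  have up : (1 - u) ^+ j * (1 + j%:R * u) <= 1.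
    elim: j => [|j ih]; first by rewrite mul0r addr0 mulr1.
    move: ih; rewrite exprS -natr1; have : 0 <= (1 - u) ^+ j.
      by apply: exprn_ge0; move: uM; rewrite ger0_norm //; lra.
    have : (0 : R) <= j%:R by [].
    move: uM; rewrite ger0_norm // => u1.
    move: (j%:R : R) ((1 - u) ^+ j) => a b a0 b0 ih.
    apply: le_trans ih; rewrite mulrAC mulrC ler_wpM2l //; nra.
  have t0 : 0 <= t by rewrite tE mulr_ge0 // ltW.
  rewrite ger0_norm // subrr expr0n mulr0 sub0r lerN2 tE mulrCA ler_pM2l //.
  rewrite -[leRHS]mul1r ler_pdivlMr ?ltr0n //; apply: le_trans up.
  move: uM; rewrite ger0_norm // -mulrA => u1; apply: ler_wpM2l.
    by apply: exprn_ge0; lra.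
  by rewrite -natr1; lra.
have lo : 1 + j%:R * (- u) <= (1 - u) ^+ j.
  elim: j => [|j ih]; first by rewrite mul0r addr0.
  move: ih; rewrite exprS -natr1; have : (0 : R) <= j%:R by [].
  move: (j%:R : R) ((1 - u) ^+ j) => a b a0; nra.
have t0 : t <= 0 by rewrite tE; nra.
have : 0 <= M / j.+1%:R by rewrite divr_ge0 // ltW.
have -> : j%:R / (4 * M) * (`|t| - t) ^+ 2 = j%:R * (- u) * (- t).
  by rewrite ler0_norm // /u; field; rewrite gt_eqF.
have nt0 : 0 <= - t by rewrite oppr_ge0.
move: (j%:R * - u) ((1 - u) ^+ j) (M / _) lo => a b c lo c0.
by have := ler_wpM2r nt0 lo; lra.
Qed.

(** * Approximation from the cone *)

Lemma cone_approx (R : realType) (n r : nat) (g : 'I_r -> mpoly n R) (f : mpoly n R)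
    (rho e : R) :
  (forall x : 'rV[R]_n, basic_closed g x -> 0 <= mpfun f x) -> 0 < rho -> 0 < e ->
  exists2 h, univariate_cone g h & wnorm rho (h - f) < e.
Proof.
move=> f0 rho0 e0; have rho_ge0 := ltW rho0.
pose K := [set x : 'rV[R]_n | forall i, `[- rho, rho]%classic (x ord0 i)].
have cK : compact K.
  by apply: (@rV_compact R n (fun=> `[- rho, rho]%classic)) => i; exact: segment_compact.
(* A continuous nonnegative function whose zero set is [basic_closed g]. *)
pose w (x : 'rV[R]_n) := \sum_i (`|mpfun (g i) x| - mpfun (g i) x) ^+ 2.
have w0 x : 0 <= w x by apply: sumr_ge0 => i _; exact: sqr_ge0.
have cw : continuous w.
  apply: continuous_big => [|i _ x]; first exact: add_continuous.
  have cg := @mpfun_continuous R n (g i) x.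
  have cs : {for x, continuous (fun x => `|mpfun (g i) x| - mpfun (g i) x)}.
    exact: cvgB (cvg_norm cg) cg.
  exact: continuous_comp cs (@exprn_continuous _ 2 _).
have fw x : w x = 0 -> 0 <= mpfun f x.
  move=> /eqP; rewrite psumr_eq0 => [/allP wx|i _]; last exact: sqr_ge0.
  apply: f0 => i; have := wx i (mem_index_enum _).
  by rewrite sqrf_eq0 subr_eq0 => /eqP <-.
have e40 : 0 < e / 4 by rewrite divr_gt0.
have [k0 hk0] := compact_penalty cK (@mpfun_continuous R n f) cw w0 fw e40.
pose M := 1 + \sum_i wnorm rho (g i).
have M1 : 1 <= M by rewrite lerDl sumr_ge0 // => i _; exact: wnorm_ge0.
have gM i (v : 'I_n -> R) : (forall j, `|v j| <= rho) -> `|meval v (g i)| <= M.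
  move=> vrho; apply: le_trans (norm_meval_le_wnorm rho_ge0 _ vrho) _.
  rewrite /M (bigD1 i) //= addrCA lerDl addr_ge0 // sumr_ge0 // => j _.
  exact: wnorm_ge0.
have M0 : 0 < M by lra.
(* The first bound gives [j / (4 * M) >= k0], the second [r * M / (j + 1) <= e / 4]. Doubling [k]
   makes [phi] a square. *)
pose k := maxn (k0 * (Num.truncn (4 * M)).+1)%N (Num.truncn (r%:R * M / (e / 4))).+1.
pose j := (k + k)%N.
pose phi : {poly R} := (1 - M^-1 *: 'X) ^+ j.
have phiE i : horner_alg (g i) phi = (1 - M^-1 *: g i) ^+ j.
  by rewrite rmorphXn rmorphB rmorph1 /= linearZ /= horner_algX mulr_algl.
(* The constant [e / 2] pays for [e / 4] lost in [compact_penalty] and [e / 4] in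
   [penalty_lower_bound], so [p] is nonnegative on the box. *)
pose p := f - \sum_i horner_alg (g i) phi * g i + mpolyC n (e / 2).
have : sos_limit rho p.
  apply: sos_limit_box => // v vrho.
  rewrite /p mevalD mevalB mevalC (raddf_sum (meval v)).
  have Kv : K (\row_i v i).
    by move=> i; rewrite /= mxE in_itv /= -ler_norml.
  have vE q : mpfun q (\row_i v i) = meval v q.
    by apply: meval_eq => i; rewrite mxE.
  have k0j : (k0 <= k0)%N by [].
  have := hk0 k0 _ k0j Kv; rewrite vE.
  have : j%:R / (4 * M) * w (\row_i v i) - r%:R * (M / j.+1%:R) <=
         - \sum_i meval v (horner_alg (g i) phi * g i).
    rewrite /w mulr_sumr.
    have -> : r%:R * (M / j.+1%:R) = \sum_(i < r) M / j.+1%:R.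
      by rewrite sumr_const card_ord mulr_natl.
    rewrite -sumrB -sumrN; apply: ler_sum => i _; rewrite vE phiE.
    rewrite mevalM rmorphXn rmorphB rmorph1 /= mevalZ [M^-1 * _]mulrC.
    by apply: penalty_lower_bound => //; exact: gM.
  have : r%:R * (M / j.+1%:R) <= e / 4.
    rewrite mulrA ler_pdivrMr ?ltr0n // [e / 4 * _]mulrC -ler_pdivrMr //.
    rewrite (le_trans (ltW (truncnS_gt _))) // ler_nat.
    by rewrite (@leq_trans k) ?leq_maxr // leqW // leq_addr.
  have : k0%:R <= j%:R / (4 * M).
    rewrite ler_pdivlMr; last by lra.
    apply: (@le_trans _ _ (k0 * (Num.truncn (4 * M)).+1)%:R).
      by rewrite natrM ler_wpM2l // ltW // truncnS_gt.
    rewrite ler_nat (@leq_trans k) ?leq_maxl //.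
    exact: leq_addr.
  have := w0 (\row_i v i).
  move: (k0%:R : R) (j%:R / (4 * M)) (w _) => a b c c0 ab.
  have : a * c <= b * c by rewrite ler_wpM2r.
  by move: (\sum_i _ : R) (meval v f) (r%:R * _) (a * c) (b * c) => *; lra.
have e20 : 0 < e / 2 by rewrite divr_gt0.
move=> /(_ _ e20)[s sos_s hs].
exists (s + \sum_i horner_alg (g i) phi * g i).
  exists s, phi; split => //; exists [:: (1 - M^-1 *: 'X) ^+ k].
  by rewrite big_seq1 -exprM muln2 -addnn.
have -> : s + \sum_i horner_alg (g i) phi * g i - f = mpolyC n (e / 2) - (p - s).
  by rewrite /p; ring.
apply: le_lt_trans (wnormD rho_ge0 _ _) _.
rewrite wnormN wnormC (gtr0_norm e20).
by rewrite [ltRHS]splitr ltrD2l.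
Qed.

(** Composition with [g i] is a ring morphism, so it preserves sums of squares. *)
Lemma univariate_cone_sub (R : realType) (n r : nat) (g : 'I_r -> mpoly n R) :
  univariate_cone g `<=` quadratic_module g.
Proof.
move=> _ [s0 [phi [sos_s0 [l ->] ->]]]; exists s0.
exists (fun i => horner_alg (g i) (\sum_(q <- l) q ^+ 2)); split=> // i.
exists [seq horner_alg (g i) q | q <- l].
by rewrite rmorph_sum big_map; apply: eq_bigr => q _; rewrite rmorphXn.
Qed.

Theorem theorem1p1 (R : realType) (n r : nat) (g : 'I_r -> mpoly n R)
    (f : mpoly n R)
    (f_ge0 : forall x : 'rV[R]_n, basic_closed g x -> 0 <= mpfun f x) :
  exists F : nat -> mpoly n R,
    [/\ forall nu, quadratic_module g (F nu),
        {family compact, (fun nu => mpfun (F nu)) @ \oo --> mpfun f},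
        forall nu, univariate_cone g (F nu) &
        (fun nu => l1norm (F nu - f)) @ \oo --> (0 : R)].
Proof.
(* The box grows while the tolerance shrinks: every compact set eventually lies in the box, and
   since the radius is at least 1, the same bound controls the l1-norm. *)
have /choice[F FP] : forall nu : nat, exists h, univariate_cone g h /\
    wnorm nu.+1%:R (h - f) < nu.+1%:R^-1.
  move=> nu; have nu0 : (0 : R) < nu.+1%:R by rewrite ltr0n.
  have nuV0 : (0 : R) < nu.+1%:R^-1 by rewrite invr_gt0.
  by have [h ? ?] := cone_approx f_ge0 nu0 nuV0; exists h.
exists F; split => [nu||nu|].
- by apply: univariate_cone_sub; have [] := FP nu.
- apply/fam_cvgP => A cA U /=; rewrite uniform_nbhs => -[E [entE EU]].
  have [e /= e0 eE] := entE.
  have [B [_ AB]] := compact_bounded cA.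
  near=> nu; apply: EU => x Ax; apply: eE; rewrite /= /ball_ /=.
  have nuB : B < nu.+1%:R.
    by rewrite (lt_trans (_ : B < nu%:R)) ?ltr_nat //; near: nu; exact: nbhs_infty_gtr.
  have nue : nu.+1%:R^-1 < e.
    rewrite invf_plt ?posrE ?ltr0n //; apply: (@lt_trans _ _ nu%:R);
      last by rewrite ltr_nat.
    by near: nu; exact: nbhs_infty_gtr.
  have [_ Fnu] := FP nu; apply: le_lt_trans (lt_trans Fnu nue).
  rewrite distrC /mpfun -mevalB; apply: norm_meval_le_wnorm => [|i]; first exact: ler0n.
  apply: le_trans (AB _ nuB x Ax).
  rewrite [leRHS]mx_normrE.
  exact: (le_bigmax _ (fun ij => `|x ij.1 ij.2|) (ord0, i)).
- by have [] := FP nu.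
- apply: (@squeeze_cvgr _ _ _ _ (cst 0) (@harmonic R)); last exact: cvg_harmonic.
    near=> nu; rewrite sumr_ge0 //= ltW //.
    have [_ Fnu] := FP nu; apply: le_lt_trans Fnu.
    by apply: l1norm_le_wnorm; rewrite ler1n.
  exact: cvg_cst.
Unshelve. all: by end_near. Qed.
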